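(* Let $f=[g:g_1,\dots,g_s;h_1,\dots,h_r]$ be a differentiable convertible nonconvex function and let $(\boldsymbol{x}^*,\boldsymbol{y}^* )\in X(g)$. Suppose that at least one of the following two conditions holds: (a) $(\boldsymbol{x},\boldsymbol{y})-(\boldsymbol{x}^*,\boldsymbol{y}^* )\in T_0(\boldsymbol{x}^*,\boldsymbol{y}^* )$ for all $(\boldsymbol{x},\boldsymbol{y})\in X(g)$; (b) $X(f)\cap K_g(\boldsymbol{x}^*,\boldsymbol{y}^* )\cap\big[\,T(\boldsymbol{x}^*,\boldsymbol{y}^* )\setminus T_0(\boldsymbol{x}^*,\boldsymbol{y}^* )+(\boldsymbol{x}^*,\boldsymbol{y}^* )\,\big]=\emptyset$. If there is an optimal solution $\boldsymbol{d}^*$ to the linear program $\mathrm{(CNP0)}(\boldsymbol{x}^*,\boldsymbol{y}^* )$ such that $\nabla g(\boldsymbol{x}^*,\boldsymbol{y}^* )^\top\boldsymbol{d}^*\ge 0$, then $(\boldsymbol{x}^*,\boldsymbol{y}^* )$ is an optimal solution to (CNP), $\boldsymbol{x}^*$ is an optimal solution to (UOP), and there are $\boldsymbol{u}^*=(u_1^*,\dots,u_s^* )^\top\ge 0$ and $\boldsymbol{v}^*=(v_1^*,\dots,v_r^* )^\top\in R^r$ such that $$\nabla g(\boldsymbol{x}^*,\boldsymbol{y}^* )+\sum_{i=1}^s u_i^*\nabla g_i(\boldsymbol{x}^*,\boldsymbol{y}^* )+\sum_{j=1}^r v_j^*\nabla h_j(\boldsymbol{x}^*,\boldsymbol{y}^*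 )=0,\qquad u_i^*g_i(\boldsymbol{x}^*,\boldsymbol{y}^* )=0\ \ (i=1,\dots,s).$$
   Context: Let $f:R^n\to R$ be nonconvex or nonsmooth and let $g,g_i,h_j:R^n\times R^m\to R$ ($i=1,\dots,s$; $j=1,\dots,r$) be convex. Put $X(f)=\{(\boldsymbol{x},\boldsymbol{y}): g_i(\boldsymbol{x},\boldsymbol{y})\le 0\ (i=1,\dots,s),\ h_j(\boldsymbol{x},\boldsymbol{y})=0\ (j=1,\dots,r)\}$, $X(f(\boldsymbol{x}))=\{\boldsymbol{y}\in R^m: (\boldsymbol{x},\boldsymbol{y})\in X(f)\}$ for fixed $\boldsymbol{x}$, and $X(g)=\{(\boldsymbol{x},\boldsymbol{y})\in X(f): g(\boldsymbol{x},\boldsymbol{y})=f(\boldsymbol{x})\}$. The function $f$ is a convertible nonconvex function, written $f=[g:g_1,\dots,g_s;h_1,\dots,h_r]$, if for each $\boldsymbol{x}\in R^n$ there is $\bar{\boldsymbol{y}}\in X(f(\boldsymbol{x}))$ with $f(\boldsymbol{x})=g(\boldsymbol{x},\bar{\boldsymbol{y}})$ and $f(\boldsymbol{x})=\min_{\boldsymbol{y}\in X(f(\boldsymbol{x}))}g(\boldsymbol{x},\boldsymbol{y})$. It is a differentiable convertible nonconvex function if moreover all of $g,g_i,h_j$ are differentiable (with $s>0$); $f$ itself need not be differentiable or convex. (UOP) is the problem: minimize $f(\boldsymbol{x})$ over $\boldsymbol{x}\in R^n$. (CNP) is the problem: minimize $g(\boldsymbol{x},\boldsymbol{y})$ subject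 to $(\boldsymbol{x},\boldsymbol{y})\in X(f)$. Optimal solution means global optimal solution. Gradients are with respect to $(\boldsymbol{x},\boldsymbol{y})$. For fixed $(\boldsymbol{x},\boldsymbol{y})$ define $T(\boldsymbol{x},\boldsymbol{y})=\{\boldsymbol{d}\in R^n\times R^m: g_i(\boldsymbol{x},\boldsymbol{y})+\nabla g_i(\boldsymbol{x},\boldsymbol{y})^\top\boldsymbol{d}\le 0\ (i=1,\dots,s),\ \nabla h_j(\boldsymbol{x},\boldsymbol{y})^\top\boldsymbol{d}\le 0\ (j=1,\dots,r)\}$, $T_0(\boldsymbol{x},\boldsymbol{y})=\{\boldsymbol{d}\in R^n\times R^m: g_i(\boldsymbol{x},\boldsymbol{y})+\nabla g_i(\boldsymbol{x},\boldsymbol{y})^\top\boldsymbol{d}\le 0\ (i=1,\dots,s),\ \nabla h_j(\boldsymbol{x},\boldsymbol{y})^\top\boldsymbol{d}=0\ (j=1,\dots,r)\}$, and $K_g(\boldsymbol{x}^*,\boldsymbol{y}^* )=\{(\boldsymbol{x},\boldsymbol{y})\in R^n\times R^m: \nabla g(\boldsymbol{x}^*,\boldsymbol{y}^* )^\top[(\boldsymbol{x},\boldsymbol{y})-(\boldsymbol{x}^*,\boldsymbol{y}^* )]<0\}$. The set $T\setminus T_0+(\boldsymbol{x}^*,\boldsymbol{y}^* )$ is the translate of $T\setminus T_0$ by $(\boldsymbol{x}^*,\boldsymbol{y}^* )$. $\mathrm{(CNP0)}(\boldsymbol{x},\boldsymbol{y})$ is the linear program: minimize $\nabla g(\boldsymbol{x},\boldsymbol{y})^\top\boldsymbol{d}$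 subject to $\boldsymbol{d}\in T_0(\boldsymbol{x},\boldsymbol{y})$. *)

(* Defs.v *)
From HB Require Import structures.
From mathcomp Require Import all_boot all_order all_algebra.
From mathcomp Require Import all_classical all_reals all_analysis.

Set Implicit Arguments.
Unset Strict Implicit.
Unset Printing Implicit Defensive.

Import Order.TTheory GRing.Theory Num.Theory.
Import numFieldNormedType.Exports.

Local Open Scope classical_set_scope.
Local Open Scope ring_scope.

Section Optimization.
Context {R : realType}.

Definition optimal_solution {V : Type} (phi : V -> R) (A : set V) (z : V) : Prop :=
  A z /\ forall w, A w -> phi z <= phi w.

(** "Nonsmooth" is read as "not differentiable everywhere".  Together with
    convexity, differentiability on R^n already gives C^1, so "nonconvex or
    nonsmooth" has the same meaning when "smooth" is read as C^1. *)
Definition smooth {V : normedModType R} (phi : V -> R^o) : Prop :=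
  forall p, differentiable phi p.

Definition convex {V : lmodType R} (phi : V -> R^o) : Prop :=
  convex_function [set: convex_lmodType V] phi.

End Optimization.

Section ProductSpace.
Context {R : realType} {n m : nat}.
Local Notation E := ('rV[R]_n * 'rV[R]_m)%type.

Definition dot (u d : E) : R :=
  \sum_(i < n) u.1 0 i * d.1 0 i + \sum_(j < m) u.2 0 j * d.2 0 j.

(** The gradient with respect to (x, y), as the pair (grad_x phi, grad_y phi). *)
Definition grad (phi : E -> R^o) (p : E) : E :=
  (\row_(i < n) 'D_((delta_mx 0 i, 0) : E) phi p,
   \row_(j < m) 'D_((0, delta_mx 0 j) : E) phi p).

End ProductSpace.

Section Convertible.
Context {R : realType} {n m s r : nat}.
Local Notation E := ('rV[R]_n * 'rV[R]_m)%type.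
Variables (f : 'rV[R]_n -> R^o) (g : E -> R^o).
Variables (gi : 'I_s -> E -> R^o) (hj : 'I_r -> E -> R^o).

(** X(f); it depends only on the constraint functions. *)
Definition feasible : set E :=
  [set p | (forall i, gi i p <= 0) /\ (forall j, hj j p = 0)].

(** X(f(x)). *)
Definition fiber (x : 'rV[R]_n) : set 'rV[R]_m := [set y | feasible (x, y)].

(** X(g). *)
Definition exact_points : set E := [set p | feasible p /\ g p = f p.1].

(** [f = [g : g_1, ..., g_s; h_1, ..., h_r]]. *)
Definition convertible : Prop :=
  [/\ convex g,
      forall i, convex (gi i),
      forall j, convex (hj j) &
      forall x, exists2 ybar,
        optimal_solution (fun y => g (x, y)) (fiber x) ybar
        & f x = g (x, ybar)].

Definition differentiable_convertible : Prop :=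
  [/\ convertible,
      (0 < s)%N,
      smooth g,
      forall i, smooth (gi i) &
      forall j, smooth (hj j)].

(** T(p), and T_0(p) below: in T(p) the linearized equality constraints are
    relaxed to inequalities. *)
Definition lin_feasible_le (p : E) : set E :=
  [set d | (forall i, gi i p + dot (grad (gi i) p) d <= 0) /\
           (forall j, dot (grad (hj j) p) d <= 0)].

Definition lin_feasible_eq (p : E) : set E :=
  [set d | (forall i, gi i p + dot (grad (gi i) p) d <= 0) /\
           (forall j, dot (grad (hj j) p) d = 0)].

(** K_g(p) is a set of points, whereas T(p) and T_0(p) are sets of directions. *)
Definition descent_halfspace (p : E) : set E :=
  [set q | dot (grad g p) (q - p) < 0].

End Convertible.

(* Main.v *)
Require Import Defs.
From HB Require Import structures.
From mathcomp Require Import all_boot all_order all_algebra.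
From mathcomp Require Import all_classical all_reals all_analysis.
From mathcomp Require Import ring lra.

Set Implicit Arguments.
Unset Strict Implicit.
Unset Printing Implicit Defensive.

Import Order.TTheory GRing.Theory Num.Theory.
Import numFieldNormedType.Exports.

Local Open Scope classical_set_scope.
Local Open Scope ring_scope.

(** Write ps = (xs, ys).  That the linear program at ps has a nonnegative
    optimal value means that grad g(ps) is nonnegative on the whole of T_0(ps),
    and both halves of the conclusion are consequences of this.

    Optimality.  A differentiable convex function lies above its linearization
    ([convex_grad_le]), so g(p) >= g(ps) whenever p - ps is in T_0(ps).  The
    two alternative conditions are two ways of reaching all feasible p.  Under
    (a), lower p = (x, y) inside its fiber to a point (x, ybar) where g equals
    f(x): this point is exact, hence in ps + T_0(ps), and g did not increase.
    Under (b), convexity of the constraints puts p - ps in T(ps)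
    ([feasible_sub_lin_feasible_le]); if it is not in T_0(ps), the emptiness of
    the intersection forbids grad g(ps) to be negative on it.  Either way ps is
    optimal for g, and xs is optimal for f because g(ps) = f(xs) and every value
    of f is a feasible value of g.

    Multipliers.  A direction d along which the gradients of the active
    inequalities are nonpositive and those of the equalities vanish enters T_0(ps) after
    shrinking ([active_cone_scaled]), so grad g(ps) is nonnegative on the cone
    of such d.  Farkas' lemma ([farkas]) then writes - grad g(ps) as a
    combination of constraint gradients, with inactive inequalities absent;
    this absence is complementary slackness. *)

(** * Farkas' lemma *)

(** Bartl's induction on the number of functionals.  If [a i0] cannot be
    dropped, some d0 satisfies the other inequalities and violates the one for
    b; then [a i0] is positive at d0, and subtracting the right multiple of
    [a i0] makes every functional vanish at d0.  The projected family satisfies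
    the hypothesis without [a i0], and undoing the projection only creates a
    nonnegative coefficient for [a i0].  Coefficients are indexed by the whole
    of I and vanish off P, so that the induction only modifies the value at
    i0. *)
Lemma farkas (R : realFieldType) (U V : lmodType R)
    (B : {bilinear U -> V -> R | *%R & *%R}) (I : finType) (P : {set I})
    (a : I -> U) (b : U) :
  (forall d, (forall i, i \in P -> B (a i) d <= 0) -> B b d <= 0) ->
  exists u : I -> R, [/\ forall i, 0 <= u i,
    forall i, i \notin P -> u i = 0 &
    forall d, B b d = \sum_i u i * B (a i) d].
Proof.
have [k] := ubnP #|P|; elim: k => // k IHk in P a b *; rewrite ltnS => cardP Hb.
have [P0|[i0 Pi0]] := set_0Vmem P.
  exists (fun=> 0); split=> // d; rewrite big1 => [|i _]; last by rewrite mul0r.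
  have Bb0 d' : B b d' <= 0 by apply: Hb => i; rewrite P0 inE.
  by apply/eqP; rewrite eq_le Bb0 -oppr_le0 -linearNr Bb0.
have cardP0 : (#|P :\ i0| < k)%N by rewrite (cardsD1 i0 P) Pi0 in cardP.
have [Hb0|/existsNP[d0 /not_implyP[ad0 /negP]]] :=
  pselect (forall d, (forall i, i \in P :\ i0 -> B (a i) d <= 0) -> B b d <= 0).
  have [u [u0 uP ub]] := IHk _ _ _ cardP0 Hb0.
  exists u; split=> // i iP; apply: uP.
  by rewrite inE negb_and iP orbT.
rewrite -ltNge => bd0.
(* Otherwise d0 would satisfy all the inequalities, contradicting Hb. *)
have a0d0 : 0 < B (a i0) d0.
  rewrite ltNge; apply/negP => a0d0; move: bd0; rewrite ltNge Hb// => i Pi.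
  by have [->//|ii0] := eqVneq i i0; apply: ad0; rewrite !inE ii0.
pose t c := B c d0 / B (a i0) d0.
pose proj c := c - t c *: a i0.
have projE c d : B (proj c) d = B c d - t c * B (a i0) d.
  by rewrite linearBl linearZl_LR.
have [|u [u0 uP ub]] := IHk (P :\ i0) (proj \o a) (proj b) cardP0.
  move=> d pd.
  (* Moving d along d0 into the kernel of [a i0] amounts to projecting. *)
  have shiftE c : B c (d - (B (a i0) d / B (a i0) d0) *: d0) = B (proj c) d.
    rewrite projE linearBr linearZr_LR /t /=; congr (_ - _).
    by rewrite mulrAC [RHS]mulrAC [B c d0 * _]mulrC.
  rewrite -shiftE; apply: Hb => i Pi; rewrite shiftE.
  have [->|ii0] := eqVneq i i0; last by apply: pd; rewrite !inE ii0.
  by rewrite projE /t divff ?gt_eqF// mul1r subrr.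
pose c := t b - \sum_i u i * t (a i).
have c0 : 0 <= c.
  rewrite subr_ge0 (le_trans (y := 0))//; last first.
    by rewrite divr_ge0// ltW.
  apply: sumr_le0 => i _; have [iP|/uP ->] := boolP (i \in P :\ i0).
    by rewrite mulr_ge0_le0// /t mulr_le0_ge0 ?ad0// invr_ge0 ltW.
  by rewrite mul0r.
exists (fun i => u i + c * (i == i0)%:R); split=> [i|i iP|d].
- by rewrite addr_ge0// mulr_ge0.
- rewrite uP ?inE ?negb_and ?iP ?orbT// add0r.
  by case: eqP iP => [->|_ _]; rewrite ?Pi0// mulr0.
- under eq_bigr do rewrite mulrDl.
  rewrite big_split/=.
  rewrite (bigD1 i0 (F := fun i => _ * (_ == _)%:R * _)) //= eqxx mulr1.
  rewrite [X in _ + (_ + X)]big1 ?addr0; last first.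
    by move=> i /negPf ->; rewrite mulr0 mul0r.
  have := ub d; rewrite projE => /eqP; rewrite subr_eq => /eqP ->.
  have -> : \sum_i u i * B ((proj \o a) i) d =
      \sum_i u i * B (a i) d - (\sum_i u i * t (a i)) * B (a i0) d.
    rewrite mulr_suml -sumrB; apply: eq_bigr => i _.
    by rewrite /= projE mulrBr mulrA.
  by rewrite mulrBl addrAC addrA.
Qed.

(** * Gradients of convex functions *)

(** By convexity the slope of phi from p towards q over a time t in ]0, 1] is
    at most phi q - phi p; the directional derivative is the limit of these
    slopes as t decreases to 0. *)
Lemma convex_derive_le (R : realType) (V : normedModType R) (phi : V -> R^o)
    (p q : V) :
  convex phi -> differentiable phi p -> phi p + 'D_(q - p) phi p <= phi q.
Proof.
move=> cphi dphi; rewrite -lerBrDl.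
have dv : derivable phi p (q - p) by exact: diff_derivable.
apply: (cvgr_to_le (cvg_dnbhs_at_right dv)); near=> t.
have t0 : 0 < t by [].
have t1 : t <= 1 by near: t; apply: nbhs_right_le.
have cpq : phi (t *: q + (1 - t) *: p) <= t * phi q + (1 - t) * phi p :=
  cphi (Itv01 (ltW t0) t1) q p (mem_set I) (mem_set I).
rewrite /= [_ *: _]mulrC ler_pdivrMr//.
have -> : t *: (q - p) + p = t *: q + (1 - t) *: p.
  by rewrite scalerBr scalerBl scale1r -addrA [p - _]addrC.
lra.
Unshelve. all: by end_near. Qed.

Section Gradient.
Context {R : realType} {n m : nat}.
Local Notation E := ('rV[R]_n * 'rV[R]_m)%type.

Lemma dot_bilinear : bilinear_for *%R *%R (@dot R n m).
Proof.
split=> [d k u v|u k d e];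
  rewrite /dot /= mulrDr addrACA !mulr_sumr -!big_split /=;
  congr (_ + _); apply: eq_bigr => i _; rewrite !mxE; ring.
Qed.

HB.instance Definition _ :=
  bilinear_isBilinear.Build R E E R *%R *%R (@dot R n m) dot_bilinear.

Lemma dot_deltal (u : E) i : dot u (delta_mx 0 i, 0) = u.1 0 i.
Proof.
rewrite /dot (bigD1 i) //= !mxE !eqxx mulr1 big1 ?addr0 => [|j /negPf ji].
  by rewrite big1 ?addr0// => j _; rewrite mxE mulr0.
by rewrite !mxE eqxx ji mulr0.
Qed.

Lemma dot_deltar (u : E) j : dot u (0, delta_mx 0 j) = u.2 0 j.
Proof.
rewrite /dot [X in _ + X](bigD1 j) //= !mxE !eqxx mulr1.
rewrite [X in _ + (_ + X)]big1 ?addr0 => [|k /negPf kj].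
  by rewrite big1 ?add0r// => k _; rewrite mxE mulr0.
by rewrite !mxE eqxx kj mulr0.
Qed.

Lemma dot_inj (u v : E) : (forall d, dot u d = dot v d) -> u = v.
Proof.
move=> uv; rewrite [u]surjective_pairing [v]surjective_pairing.
by congr (_, _); apply/rowP => i; rewrite -?dot_deltal -?dot_deltar uv.
Qed.

Lemma pair_sum_delta (d : E) :
  d = \sum_(i < n) d.1 0 i *: ((delta_mx 0 i, 0) : E)
      + \sum_(j < m) d.2 0 j *: ((0, delta_mx 0 j) : E).
Proof.
rewrite [LHS]surjective_pairing [RHS]surjective_pairing.
congr (_, _); rewrite raddfD !raddf_sum /=.
  rewrite [X in _ + X]big1 ?addr0 => [|j _]; last by rewrite scaler0.
  exact: row_sum_delta.
rewrite big1 ?add0r => [|j _]; last by rewrite scaler0.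
exact: row_sum_delta.
Qed.

(** [grad] records the partial derivatives only; it represents the directional
    derivatives because these are linear in the direction when phi is
    differentiable. *)
Lemma dot_grad (phi : E -> R^o) p d :
  differentiable phi p -> dot (grad phi p) d = 'D_d phi p.
Proof.
move=> dphi; rewrite deriveE// {2}[d]pair_sum_delta linearD !linear_sum /dot.
by congr (_ + _); apply: eq_bigr => i _; rewrite linearZ /= !mxE deriveE// mulrC.
Qed.

Lemma convex_grad_le (phi : E -> R^o) p q :
  convex phi -> differentiable phi p ->
  phi p + dot (grad phi p) (q - p) <= phi q.
Proof. by move=> cphi dphi; rewrite dot_grad//; exact: convex_derive_le. Qed.

End Gradient.

(** * Linearized constraints and multipliers *)

Section Multipliers.
Context {R : realType} {n m s r : nat}.
Local Notation E := ('rV[R]_n * 'rV[R]_m)%type.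
Variables (gi : 'I_s -> E -> R^o) (hj : 'I_r -> E -> R^o) (p : E).
Hypothesis p_feas : feasible gi hj p.

(** Linearizations lie below convex functions, so they inherit the inequality
    constraints; for an equality constraint only the half h <= 0 survives, which
    is why T and not T_0 appears. *)
Lemma feasible_sub_lin_feasible_le q :
  (forall i, convex (gi i)) -> (forall j, convex (hj j)) ->
  (forall i, smooth (gi i)) -> (forall j, smooth (hj j)) ->
  feasible gi hj q -> lin_feasible_le gi hj p (q - p).
Proof.
move=> cg ch dg dh [gq hq]; case: p_feas => _ hp; split=> [i|j].
  exact: le_trans (convex_grad_le _ (cg i) (dg i p)) (gq i).
by have := convex_grad_le q (ch j) (dh j p); rewrite hp hq add0r.
Qed.

(** The inactive constraints are strictly negative at p, which leaves room for
    a small step along any direction. *)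
Lemma active_cone_scaled d :
  (forall i, gi i p = 0 -> dot (grad (gi i) p) d <= 0) ->
  (forall j, dot (grad (hj j) p) d = 0) ->
  exists2 t, 0 < t & lin_feasible_eq gi hj p (t *: d).
Proof.
move=> gd hd; case: p_feas => gp _.
pose c i := dot (grad (gi i) p) d.
pose S := \sum_i `|c i / gi i p|.
have S0 : 0 <= S by apply: sumr_ge0.
(* The step works because (1 + S) * `|gi i p| dominates every slope c i. *)
exists (1 + S)^-1; first by rewrite invr_gt0; lra.
split=> [i|j]; rewrite linearZr_LR /=; last by rewrite hd mulr0.
have [gi0|gi0] := eqVneq (gi i p) 0.
  by rewrite gi0 add0r mulr_ge0_le0 ?gd// invr_ge0; lra.
have gilt : gi i p < 0 by rewrite lt_neqAle gi0 gp.
have ciS : `|c i / gi i p| <= S.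
  by rewrite /S (bigD1 i)//= lerDl sumr_ge0.
have cS : c i <= (1 + S) * - gi i p.
  rewrite normrM normfV (ltr0_norm gilt) ler_pdivrMr ?oppr_gt0// in ciS.
  apply: le_trans (ler_norm _) (le_trans ciS _).
  by rewrite ler_wpM2r ?oppr_ge0 ?gp// lerDr.
rewrite -/(c i) -[X in X + _]opprK addrC subr_le0 mulrC.
by rewrite ler_pdivrMr 1?mulrC//; lra.
Qed.

(** Farkas' lemma handles inequalities, so each equality constraint enters as
    two opposite gradients, indexed by a sign bit; the difference of the two
    nonnegative coefficients is its multiplier of arbitrary sign. *)
Lemma lin_multipliers (g : E -> R^o) :
  (forall d, lin_feasible_eq gi hj p d -> 0 <= dot (grad g p) d) ->
  exists (u : 'I_s -> R) (v : 'I_r -> R),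
    [/\ forall i, 0 <= u i,
        grad g p + \sum_(i < s) u i *: grad (gi i) p
          + \sum_(j < r) v j *: grad (hj j) p = 0 &
        forall i, u i * gi i p = 0].
Proof.
move=> gd.
pose a (k : 'I_s + 'I_r * bool) : E :=
  match k with
  | inl i => grad (gi i) p
  | inr (j, b) => (-1) ^+ b *: grad (hj j) p
  end.
pose P : {set 'I_s + 'I_r * bool} :=
  [set k | if k is inl i then gi i p == 0 else true]%SET.
have [|w [w0 wP wE]] := @farkas R E E (@dot R n m) _ P a (- grad g p).
  move=> d ad; rewrite linearNl oppr_le0.
  have [|j|t t0 td] := @active_cone_scaled d.
  - by move=> i gi0; apply: (ad (inl i)); rewrite inE gi0.
  - apply/eqP; rewrite eq_le.
    have := ad (inr (j, false)); rewrite inE /= expr0 scale1r => -> //=.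
    have := ad (inr (j, true)); rewrite inE /= expr1 scaleN1r linearNl.
    by rewrite oppr_le0 => ->.
  - by have := gd _ td; rewrite linearZr_LR pmulr_rge0.
exists (fun i => w (inl i)), (fun j => w (inr (j, false)) - w (inr (j, true))).
split=> [i||i]; first exact: w0.
- apply: dot_inj => d; rewrite linear0l !linearDl !linear_sumlz /=.
  transitivity (dot (grad g p) d + \sum_k w k * dot (a k) d); last first.
    by rewrite -wE linearNl subrr.
  rewrite big_sumType -[LHS]addrA; congr (_ + (_ + _)).
    by apply: eq_bigr => i _; rewrite linearZl_LR.
  rewrite (eq_bigr (fun jb =>
    w (inr (jb.1, jb.2)) * dot (a (inr (jb.1, jb.2))) d)); last by case.
  rewrite -(pair_bigA _ (fun j b => w (inr (j, b)) * dot (a (inr (j, b))) d)) /=.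
  apply: eq_bigr => j _; rewrite linearZl_LR big_bool /=.
  rewrite expr0 expr1 scale1r scaleN1r linearNl /=.
  by ring.
- have [->|gi0] := eqVneq (gi i p) 0; first by rewrite mulr0.
  by rewrite wP ?mul0r// inE.
Qed.

End Multipliers.

Theorem theorem4 (R : realType) (n m s r : nat)
  (f : 'rV[R]_n -> R^o) (g : 'rV[R]_n * 'rV[R]_m -> R^o)
  (gi : 'I_s -> 'rV[R]_n * 'rV[R]_m -> R^o)
  (hj : 'I_r -> 'rV[R]_n * 'rV[R]_m -> R^o)
  (f_nonconvex_or_nonsmooth : ~ convex f \/ ~ smooth f)
  (f_conv : differentiable_convertible f g gi hj)
  (xs : 'rV[R]_n) (ys : 'rV[R]_m)
  (xys_exact : exact_points f g gi hj (xs, ys))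
  (cond_ab :
    (forall p, exact_points f g gi hj p ->
       lin_feasible_eq gi hj (xs, ys) (p - (xs, ys)))
    \/
    feasible gi hj `&` descent_halfspace g (xs, ys) `&`
      [set d + (xs, ys) |
         d in lin_feasible_le gi hj (xs, ys) `\` lin_feasible_eq gi hj (xs, ys)]
    = set0)
  (cnp0_opt : exists2 ds : 'rV[R]_n * 'rV[R]_m,
     optimal_solution (dot (grad g (xs, ys))) (lin_feasible_eq gi hj (xs, ys)) ds
     & 0 <= dot (grad g (xs, ys)) ds) :
  [/\ optimal_solution g (feasible gi hj) (xs, ys),
      optimal_solution f [set: 'rV[R]_n] xs &
      exists (u : 'I_s -> R) (v : 'I_r -> R),
        [/\ forall i, 0 <= u i,
            grad g (xs, ys) + \sum_(i < s) u i *: grad (gi i) (xs, ys)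
              + \sum_(j < r) v j *: grad (hj j) (xs, ys) = 0 &
            forall i, u i * gi i (xs, ys) = 0]].
Proof.
case: f_conv => -[cg cgi chj fE] _ dg dgi dhj.
case: xys_exact => ps_feas gps; rewrite /= in gps.
set ps := (xs, ys) in cond_ab cnp0_opt ps_feas gps *.
have gd d : lin_feasible_eq gi hj ps d -> 0 <= dot (grad g ps) d.
  by case: cnp0_opt => ds [_ dsmin] ds0 /dsmin; exact: le_trans.
have grad_le p : 0 <= dot (grad g ps) (p - ps) -> g ps <= g p.
  move=> gp0; apply: le_trans (convex_grad_le p cg (dg ps)).
  by rewrite lerDl.
have ps_min p : feasible gi hj p -> g ps <= g p.
  move=> p_feas; case: cond_ab => [exact_lin|disj].
    have [y [y_fiber ymin] fy] := fE p.1.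
    have y_exact : exact_points f g gi hj (p.1, y) by [].
    have /gd/grad_le := exact_lin _ y_exact.
    have p2_fiber : fiber gi hj p.1 p.2 by rewrite /fiber /= -surjective_pairing.
    move=> gsy; have := ymin _ p2_fiber.
    by rewrite -surjective_pairing; exact: le_trans gsy.
  apply: grad_le; rewrite leNgt; apply/negP => p_desc.
  suff : set0 p by [].
  rewrite -disj; split=> //; exists (p - ps); last by rewrite subrK.
  split; first exact: feasible_sub_lin_feasible_le.
  by move=> /gd; rewrite leNgt p_desc.
split; first by split.
- split=> // x _; have [y [y_fiber _] ->] := fE x.
  by rewrite -gps; exact: ps_min.
- exact: lin_multipliers.
Qed.
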